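(* The Chop Chop protocol (described in the context) satisfies integrity: in every execution, if a correct server delivers a message $m$ from a correct client $\chi$, then $\chi$ previously broadcast $m$.
   Context: MODEL. Asynchronous message passing over authenticated reliable point-to-point links between clients, brokers, and $3f+1$ servers (a fixed known set). At most $f$ servers are Byzantine; any number of clients and brokers may be Byzantine, but at least one broker is correct. Cryptography is ideal: signatures and multi-signatures are unforgeable; multi-signatures of several processes on the same statement can be aggregated and verified; Merkle roots are collision-resistant, with proofs of inclusion. A directory $dir$ gives each client a unique integer identifier $id$, together with a transferable certified assignment ($id\leftrightarrow$ client) that anyone can import. Servers have access to a Server Total Order Broadcast (STOB) satisfying: no duplication (no message broadcast by a correct server is delivered more than once by a correct server), integrity (a delivered message was broadcast by some server), validity (a message broadcast by a correct server is eventually delivered by a correct server), agreement (a message delivered by one correct server is eventually delivered by all correct servers), total order (for different $m,m'$: if a correct server delivers $m$ without having delivered $m'$, no correct server delivers $m'$ before $m$). A statement is *certified* if it carries multi-signatures of $f+1$ distinct servers. An *evidence* with number $n$ is a certified statement $[\mathrm{Completion},r,n]$. INTERFACE. Clients trigger $\mathrm{Broadcast}(m)$; servers trigger $\mathrm{Deliver}(\chi,m)$. Correct clients obey: (CR1) a new message is broadcast only after receiving the completion certificate of the previous one; (CR2) the same message is never broadcast twice in a row. Correct brokers obey: (BR1) a new batch is sent to the servers only once the previously sent one has been delivered by STOB (at the correct servers). CLIENT $\chi$ with identifier $id$. State: counter $s=0$, an evidence, and for each pending message $m$ and broker $\beta$ a set $S_{m,\beta}$ of used sequence numbers. On $\mathrm{Broadcast}(m)$: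 mark $m$ pending and submit. Submit: choose a broker $\beta$ not yet tried for $m$, send it $[\mathrm{Submission},$ assignment of $id$, $m,s,$ signature on $[\mathrm{Message},m,s]$, evidence$]$, add $s$ to $S_{m,\beta}$, and start a finite timer; when it rings and $m$ is still pending, submit again. (By definition a submission by a correct client with $s>0$ carries an evidence with number $\ge s$.) On $[\mathrm{Inclusion},m,root,proof,k,E]$ from $\beta$, where $m$ is pending and was submitted to $\beta$: if $proof$ shows that $(id,k,m)$ is a leaf under $root$, $E$ is a valid evidence, $k\le$ number of $E$, and $k\ge s$, then set $s:=k$, store $E$, add $k$ to $S_{m,\beta}$ and send $\beta$ a multi-signature on $[\mathrm{Reduction},root]$. On $[\mathrm{Completion},r,m,k,proof,n,cert]$ from $\beta$, where $cert$ certifies $[\mathrm{Completion},r,n]$: keep it as evidence if $n$ exceeds the stored number; if $m$ is pending, $k\in S_{m,\beta}$ and $proof$ shows $(id,k,m)$ is a leaf under $r$, then set $s:=s+1$ and make $m$ no longer pending (this is receiving the completion certificate). BROKER $\beta$. Batch counter starts at 1. Import the assignment in each Submission; accept it if its signature is valid and either its sequence number is $0$ or its evidence is valid with number $\ge$ its sequence number. Accepted submissions are queued per identifier and moved into a pool containing at most one submission per identifier. When a pool is nonempty a finite timer is started; when it rings, the pool is emptied into a batch: $k$ is the maximum of its sequence numbers, $root$ is the Merkle root of all leaves $(id,k,m)$, and each client is sent $[\mathrm{Inclusion},m,root,proof,k,E]$ with $E$ the submitted evidence of largest number. After another finite timer, clients in the batch that have not sent a valid multi-signature on $[\mathrm{Reduction},root]$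 are *stragglers*, keeping their original sequence number and signature. Let $r$ be the Merkle root of the leaves $(id,k',m)$, where $k'$ is the original sequence number for stragglers and $k'=k$ otherwise. The broker sends all servers $[\mathrm{Batch},num,ids,payloads,stragglers]$ (payloads are the pairs $(k,m)$; stragglers maps straggler identifiers to original sequence numbers), where $num$ is the batch counter, which is then incremented. On $[\mathrm{BatchAcquired},r,unknowns]$ from a server, it replies with $[\mathrm{Signatures},r,num,$ assignments of $unknowns$, aggregate of the multi-signatures, straggler signatures$]$. On collecting $f+1$ valid server multi-signatures on $[\mathrm{Witness},(r,\beta,num)]$ it aggregates them into a witness certificate $W$ and sends $[\mathrm{Witness},r,num,W]$ to all servers. On collecting $f+1$ valid matching completion shards (below) for the batch, it aggregates them into a certificate and sends to every client in the batch whose leaf is not $\bot$ the message $[\mathrm{Completion},r',m,k'',proof,n,cert]$, where $r'$ is the completion root and $(id,k'',m)$ the client's leaf in it. SERVER. State: $batches$ (map from keys $(root,broker,number)$ to batches); for each broker $\beta$ an expected number $e_\beta=1$ and an expected root (initially empty); FIFO queue $pool$; for each identifier $last[id]$, initially $(-1,\bot)$; delivery counter $c=1$; per-broker count $d_\beta=0$ of completed batches. (1) On $[\mathrm{Batch},num,ids,payloads,stragglers]$ from $\beta$: sort entries by identifier, compute the Merkle root $r$ of leaves $(id,k',m)$ with straggler sequence numbers substituted; if key $(r,\beta,num)\notin batches$, $num=e_\beta$, the expected root of $\beta$ is empty, identifiers are distinct and lengths match, then store the batch under the key, set the expected root to $r$, and reply $[\mathrm{BatchAcquired},r,\text{identifiers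 unknown to } dir]$. (2) On $[\mathrm{Signatures},r,num,\dots]$ from $\beta$: import the assignments; require that $r$ is the expected root of $\beta$, $num=e_\beta$, the batch is stored under $(r,\beta,num)$, and all its identifiers are known. Check that exactly the stragglers come with individual signatures, each valid on $[\mathrm{Message},m,\text{straggler number}]$, and that the aggregate multi-signature is valid for all other identifiers on $[\mathrm{Reduction},\rho]$, with $\rho$ the Merkle root of the leaves built from $ids$ and $payloads$ (without straggler substitution). If so, send $\beta$ a multi-signature on $[\mathrm{Witness},(r,\beta,num)]$. (3) On $[\mathrm{Witness},r,num,W]$ from $\beta$ with $r$ the expected root, $num=e_\beta$ and $W$ certifying $[\mathrm{Witness},(r,\beta,num)]$: STOB-broadcast $(\beta,r,W)$. (4) On STOB-delivery of $(\beta,r,W)$: let $key=(r,\beta,e_\beta)$; ignore unless $W$ certifies $[\mathrm{Witness},key]$. Otherwise increment $e_\beta$; if the expected root of $\beta$ is not $r$, send $[\mathrm{RequestBatch},key]$ to all servers; push $key$ into $pool$; remove $r$ from the expected root of $\beta$. (5) On $[\mathrm{RequestBatch},key]$ with $key\in batches$: reply with the stored batch and its assignments. On receiving such a reply for $key\in pool$, $key\notin batches$: import the assignments, sort by identifier, recompute the root (with straggler substitution) and store the batch under $key$ if all identifiers are known and the root equals that of $key$. (6) When the head $key=(r,\beta,num)$ of $pool$ is in $batches$: pop it and complete the batch. For each identifier in sorted order, with message $m$ and sequence number $q$ (straggler number if a straggler, payload number otherwise) and $last[id]=(q',m')$: if $q<q'$, the completion leaf is $\bot$; else if $m=m'$,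 the leaf is $(id,q',m')$; else if $q>q'$ and $m\ne m'$, set $last[id]:=(q,m)$, leaf $(id,q,m)$, and trigger $\mathrm{Deliver}(dir[id],m)$; otherwise nothing is delivered (leaf $\bot$). Send $\beta$ a completion shard: a multi-signature on $[\mathrm{Completion},\text{Merkle root of the completion leaves},c]$ together with the list of identifiers whose leaf differs from the submitted one. Then increment $c$ and $d_\beta$ and send $[\mathrm{Collection},key]$ to all servers. (7) On $[\mathrm{Collection},(r,\beta,num)]$ with $num\le d_\beta$: reply $[\mathrm{CollectionAccept},key]$. A server that has completed $key$ and received $[\mathrm{CollectionAccept},key]$ from all $3f+1$ servers deletes $key$ from $batches$. *)

(* Defs.v *)
From HB Require Import structures.
From mathcomp Require Import all_boot.
Set Implicit Arguments.
Unset Strict Implicit.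
Unset Printing Implicit Defensive.

(* Ideal Merkle trees: [root_of] is collision-free, and an inclusion proof
   verifies against the root of [ls] only for the members of [ls].  Nothing is
   required of the elements of [mk_root] that are not the root of any list. *)
Record merkle (L : eqType) := Merkle {
  mk_root : eqType;
  mk_proof : Type;
  root_of : seq L -> mk_root;
  prove : seq L -> L -> mk_proof;
  verify : mk_root -> L -> mk_proof -> bool;
  root_of_inj : injective root_of;
  prove_verify : forall ls x, x \in ls -> verify (root_of ls) x (prove ls x);
  verify_in : forall ls x pf, verify (root_of ls) x pf -> x \in ls
}.

(* Consistency of these laws: a root may be the list itself. *)
Definition free_merkle (L : eqType) : merkle L :=
  @Merkle L (seq L) unit id (fun _ _ => tt) (fun ls x _ => x \in ls)
    (@inj_id _) (fun _ _ h => h) (fun _ _ _ h => h).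

(* [Some (id, k, m)] or, in completion trees only, [None] for the leaf _|_. *)
Definition leaf (M : eqType) : eqType := option (nat * nat * M)%type.

Definition server (f : nat) := 'I_(3 * f + 1).
Definition servers (f : nat) : seq (server f) := enum {: server f}.

Inductive proc (C B : eqType) (f : nat) :=
  | Cl of C
  | Br of B
  | Sv of server f.
Arguments Cl {C B f} c.
Arguments Br {C B f} b.
Arguments Sv {C B f} i.

Definition proc_code (C B : eqType) f (p : proc C B f) : C + B + server f :=
  match p with Cl c => inl (inl c) | Br b => inl (inr b) | Sv i => inr i end.
Definition proc_decode (C B : eqType) f (x : C + B + server f) : proc C B f :=
  match x with inl (inl c) => Cl c | inl (inr b) => Br b | inr i => Sv i end.
Lemma proc_codeK (C B : eqType) f : cancel (@proc_code C B f) (@proc_decode C B f).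
Proof. by case. Qed.
HB.instance Definition _ (C B : eqType) f :=
  Equality.copy (proc C B f) (can_type (@proc_codeK C B f)).

Definition upd (K : eqType) (V : Type) (g : K -> V) (x : K) (v : V) : K -> V :=
  fun y => if y == x then v else g y.

(* First match in an association list, which represents a finite map. *)
Fixpoint lookup (T : Type) (al : seq (nat * T)) (i : nat) : option T :=
  if al is (j, x) :: al' then if j == i then Some x else lookup al' i else None.

Section Protocol.

(* M: application messages; C: clients; B: brokers; [id_of]: the identifiers
   assigned by the directory; H: Merkle trees; [byz]: the Byzantine processes. *)
Variables (M C B : eqType) (f : nat) (id_of : C -> nat) (H : merkle (leaf M)).
Variable byz : pred (proc C B f).

Notation server := (server f).
Notation servers := (servers f).
Notation proc := (proc C B f).
Notation leaf := (leaf M).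
Notation root := (mk_root H).
Notation root_of := (@root_of leaf H).
Notation prove := (@prove leaf H).
Notation verify := (@verify leaf H).

Definition correct (p : proc) : bool := ~~ byz p.

(* (root, broker, number) *)
Definition key : eqType := (root * B * nat)%type.

Inductive stmt :=
  | StMessage of M & nat
  | StReduction of root
  | StWitness of key
  | StCompletion of root & nat.

Definition stmt_code (s : stmt) : M * nat + root + key + root * nat :=
  match s with
  | StMessage m k => inl (inl (inl (m, k)))
  | StReduction r => inl (inl (inr r))
  | StWitness k => inl (inr k)
  | StCompletion r n => inr (r, n)
  end.
Definition stmt_decode (x : M * nat + root + key + root * nat) : stmt :=
  match x with
  | inl (inl (inl (m, k))) => StMessage m k
  | inl (inl (inr r)) => StReduction r
  | inl (inr k) => StWitness k
  | inr (r, n) => StCompletion r n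
  end.
Lemma stmt_codeK : cancel stmt_code stmt_decode.
Proof. by case. Qed.
HB.instance Definition _ := Equality.copy stmt (can_type stmt_codeK).

(* Symbolic tokens: [(p, s)] is the signature of p on s, and [(ps, s)] the
   aggregate of the multi-signatures of the processes in ps on s.  Verification
   compares tokens; unforgeability is the condition [authentic] below on what
   Byzantine processes can send. *)
Definition signature : eqType := (proc * stmt)%type.
Definition multisig : eqType := (seq proc * stmt)%type.

Definition certified (s : stmt) (ms : multisig) : bool :=
  (ms.2 == s) && (f + 1 <= #|[set i : server | Sv i \in ms.1]|).

Record evidence := Evidence {
  ev_root : root; ev_num : nat; ev_cert : multisig }.
Definition valid_evidence (E : evidence) : bool :=
  certified (StCompletion (ev_root E) (ev_num E)) (ev_cert E).

(* Local copy of the directory held by a broker or a server.  The assignment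
   (id, c) is certified exactly when the directory gives id to c. *)
Definition dirmap := nat -> option C.
Definition assignment := (nat * C)%type.
Definition learn (d : dirmap) (a : assignment) : dirmap :=
  if id_of a.2 == a.1 then upd d a.1 (Some a.2) else d.
Definition learn_all (d : dirmap) (s : seq assignment) : dirmap :=
  foldl learn d s.
Definition assignments (d : dirmap) (ids : seq nat) : seq assignment :=
  pmap (fun i => omap (pair i) (d i)) ids.
Definition sound_dir (d : dirmap) : Prop :=
  forall i c, d i = Some c -> id_of c = i.

(* Entries (id, (k, m)); stragglers: straggler id |-> original number. *)
Record batch := MkBatch {
  b_entries : seq (nat * (nat * M));
  b_stragglers : seq (nat * nat) }.

Definition sort_entries (es : seq (nat * (nat * M))) : seq (nat * (nat * M)) :=
  sort (fun x y => x.1 <= y.1) es.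
Definition sort_batch (b : batch) : batch :=
  MkBatch (sort_entries (b_entries b)) (b_stragglers b).
Definition b_ids (b : batch) : seq nat := map fst (b_entries b).
Definition b_seqno (b : batch) (e : nat * (nat * M)) : nat :=
  odflt e.2.1 (lookup (b_stragglers b) e.1).
Definition batch_leaves (b : batch) : seq leaf :=
  [seq Some (e.1, b_seqno b e, e.2.2) | e <- b_entries b].
Definition reduction_leaves (b : batch) : seq leaf :=
  [seq Some (e.1, e.2.1, e.2.2) | e <- b_entries b].

Definition smsg : eqType := (B * root * multisig)%type.

(* A completion shard names its batch, and carries the differing leaves along
   with their identifiers: the broker has to rebuild the completion tree. *)
Inductive msg :=
  | Submission (a : assignment) (m : M) (s : nat) (sg : signature)
      (E : option evidence)
  | Inclusion (m : M) (rt : root) (pf : mk_proof H) (k : nat)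
      (E : option evidence)
  | Reduction (ms : multisig)
  | Completion (r : root) (m : M) (k : nat) (pf : mk_proof H) (n : nat)
      (cert : multisig)
  | Batch (num : nat) (ids : seq nat) (payloads : seq (nat * M))
      (stragglers : seq (nat * nat))
  | BatchAcquired (r : root) (unknowns : seq nat)
  | Signatures (r : root) (num : nat) (assigns : seq assignment)
      (agg : multisig) (ssigs : seq (nat * signature))
  | WitnessShard (ms : multisig)
  | Witness (r : root) (num : nat) (W : multisig)
  | CompletionShard (k : key) (ms : multisig) (diff : seq (nat * leaf))
  | RequestBatch (k : key)
  | BatchReply (k : key) (b : batch) (assigns : seq assignment)
  | Collection (k : key)
  | CollectionAccept (k : key).

Definition ev_msigs (E : option evidence) : seq multisig :=
  if E is Some E' then [:: ev_cert E'] else [::].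

Definition sigs_in (x : msg) : seq signature :=
  match x with
  | Submission _ _ _ sg _ => [:: sg]
  | Signatures _ _ _ _ ssigs => map snd ssigs
  | _ => [::]
  end.
Definition msigs_in (x : msg) : seq multisig :=
  match x with
  | Submission _ _ _ _ E | Inclusion _ _ _ _ E => ev_msigs E
  | Reduction ms | WitnessShard ms | CompletionShard _ ms _ => [:: ms]
  | Completion _ _ _ _ _ cert => [:: cert]
  | Signatures _ _ _ agg _ => [:: agg]
  | Witness _ _ W => [:: W]
  | _ => [::]
  end.

(* What a handler makes its process do besides changing its own state.
   [Deliver None m] arises if the server cannot resolve the identifier. *)
Inductive effect :=
  | Send of proc & msg
  | Sign of stmt
  | MultiSign of stmt
  | StobBroadcast of smsg
  | Deliver of option C & M.

Definition sends (fx : seq effect) : seq (proc * msg) :=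
  pmap (fun e => if e is Send q x then Some (q, x) else None) fx.
Definition signs (fx : seq effect) : seq stmt :=
  pmap (fun e => if e is Sign s then Some s else None) fx.
Definition multisigns (fx : seq effect) : seq stmt :=
  pmap (fun e => if e is MultiSign s then Some s else None) fx.
Definition stob_broadcasts (fx : seq effect) : seq smsg :=
  pmap (fun e => if e is StobBroadcast x then Some x else None) fx.
Definition deliveries (fx : seq effect) : seq (option C * M) :=
  pmap (fun e => if e is Deliver c m then Some (c, m) else None) fx.

Definition send_servers (x : msg) : seq effect :=
  [seq Send (Sv i) x | i <- servers].

(* [c_tried m]: brokers to which the pending m was submitted; [c_used m b]: the
   set S_(m,b); [c_timers]: multiset of running timers; [c_last]: the message
   broadcast last. *)
Record cstate := CState {
  c_seq : nat;
  c_ev : option evidence;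
  c_pending : seq M;
  c_tried : M -> seq B;
  c_used : M -> B -> seq nat;
  c_timers : seq M;
  c_last : option M }.

Definition c_init : cstate :=
  CState 0 None [::] (fun _ => [::]) (fun _ _ => [::]) [::] None.

Definition add_used (u : M -> B -> seq nat) (m : M) (b : B) (k : nat) :=
  upd u m (upd (u m) b (k :: u m b)).

Definition client_submit (c : C) (m : M) (b : B) (s : cstate)
    : cstate * seq effect :=
  let st := StMessage m (c_seq s) in
  (CState (c_seq s) (c_ev s) (c_pending s)
     (upd (c_tried s) m (b :: c_tried s m))
     (add_used (c_used s) m b (c_seq s))
     (m :: c_timers s) (c_last s),
   [:: Sign st;
       Send (Br b) (Submission (id_of c, c) m (c_seq s) (Cl c, st) (c_ev s))]).

Definition client_broadcast (c : C) (m : M) (b : B) (s : cstate)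
    : cstate * seq effect :=
  client_submit c m b
    (CState (c_seq s) (c_ev s) (m :: c_pending s)
       (upd (c_tried s) m [::])
       (upd (c_used s) m (fun _ => [::]))
       (c_timers s) (Some m)).

(* A timer started for m rings; [ob] is the broker chosen, if one is needed. *)
Definition client_timer (c : C) (m : M) (ob : option B) (s : cstate)
    : cstate * seq effect :=
  let s' := CState (c_seq s) (c_ev s) (c_pending s) (c_tried s) (c_used s)
              (rem m (c_timers s)) (c_last s) in
  if ob is Some b then client_submit c m b s' else (s', [::]).

Definition client_recv (c : C) (src : proc) (x : msg) (s : cstate)
    : cstate * seq effect :=
  match src, x with
  | Br b, Inclusion m rt pf k (Some E) =>
      if [&& m \in c_pending s, b \in c_tried s m,
             verify rt (Some (id_of c, k, m)) pf, valid_evidence E,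
             k <= ev_num E & c_seq s <= k]
      then let st := StReduction rt in
           (CState k (Some E) (c_pending s) (c_tried s)
              (add_used (c_used s) m b k) (c_timers s) (c_last s),
            [:: MultiSign st; Send (Br b) (Reduction ([:: Cl c], st))])
      else (s, [::])
  | Br b, Completion r m k pf n cert =>
      if certified (StCompletion r n) cert then
        let ev := if (if c_ev s is Some E then ev_num E < n else true)
                  then Some (Evidence r n cert) else c_ev s in
        if [&& m \in c_pending s, k \in c_used s m b
             & verify r (Some (id_of c, k, m)) pf]
        then (CState (c_seq s).+1 ev [seq m' <- c_pending s | m' != m]
                (c_tried s) (c_used s) (c_timers s) (c_last s), [::])
        else (CState (c_seq s) ev (c_pending s)
                (c_tried s) (c_used s) (c_timers s) (c_last s), [::])
      else (s, [::])
  | _, _ => (s, [::])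
  end.

Record submission := MkSubmission {
  su_id : nat; su_client : C; su_msg : M; su_seq : nat;
  su_sig : signature; su_ev : option evidence }.

(* A batch being reduced, with the clients that multi-signed its root. *)
Record reducing := MkReducing {
  re_subs : seq submission; re_seq : nat; re_signers : seq C }.

(* A batch sent to the servers.  [se_shards] pairs each valid completion shard
   with the completion leaves and the number that it signs. *)
Record sent_batch := MkSent {
  se_num : nat; se_red : reducing;
  se_witnesses : seq server;
  se_shards : seq (server * (seq leaf * nat));
  se_completed : bool }.

(* Batches being reduced are indexed by the order in which they were flushed;
   [br_sent] has the batch sent last at its head. *)
Record bstate := BState {
  br_num : nat;
  br_dir : dirmap;
  br_queue : nat -> seq submission;
  br_pool : seq submission;
  br_flushed : nat;
  br_reducing : nat -> option reducing;
  br_sent : seq sent_batch }.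

Definition b_init (d : dirmap) : bstate :=
  BState 1 d (fun _ => [::]) [::] 0 (fun _ => None) [::].

Definition re_leaf (r : reducing) (x : submission) : leaf :=
  Some (su_id x, re_seq r, su_msg x).
Definition re_leaves (r : reducing) : seq leaf :=
  [seq re_leaf r x | x <- re_subs r].
Definition re_root (r : reducing) : root := root_of (re_leaves r).
Definition re_straggler (r : reducing) (x : submission) : bool :=
  su_client x \notin re_signers r.
Definition re_stragglers (r : reducing) : seq submission :=
  [seq x <- re_subs r | re_straggler r x].
Definition re_final_leaves (r : reducing) : seq leaf :=
  [seq Some (su_id x, if re_straggler r x then su_seq x else re_seq r, su_msg x)
  | x <- re_subs r].
Definition re_final_root (r : reducing) : root := root_of (re_final_leaves r).

Definition se_key (b : B) (x : sent_batch) : key :=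
  (re_final_root (se_red x), b, se_num x).

(* The submitted evidence of largest number; queued evidences are valid. *)
Definition best_evidence (xs : seq submission) : option evidence :=
  foldr (fun x best =>
    match su_ev x, best with
    | Some E, Some E' => if ev_num E' <= ev_num E then Some E else Some E'
    | Some E, None => Some E
    | None, _ => best
    end) None xs.

(* The head of the queue of [i] moves to the pool. *)
Definition broker_pool (i : nat) (s : bstate) : bstate :=
  if br_queue s i is x :: q then
    BState (br_num s) (br_dir s) (upd (br_queue s) i q)
      (rcons (br_pool s) x) (br_flushed s) (br_reducing s) (br_sent s)
  else s.

(* The pool timer, which runs when the pool is nonempty, rings. *)
Definition broker_flush (s : bstate) : bstate * seq effect :=
  let subs := sort (fun x y => su_id x <= su_id y) (br_pool s) in
  let r := MkReducing subs (\max_(x <- subs) su_seq x) [::] in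
  (BState (br_num s) (br_dir s) (br_queue s) [::] (br_flushed s).+1
     (upd (br_reducing s) (br_flushed s) (Some r)) (br_sent s),
   [seq Send (Cl (su_client x))
          (Inclusion (su_msg x) (re_root r) (prove (re_leaves r) (re_leaf r x))
             (re_seq r) (best_evidence subs))
   | x <- subs]).

(* The reduction timer of the j-th flushed batch rings. *)
Definition broker_send (j : nat) (s : bstate) : bstate * seq effect :=
  if br_reducing s j is Some r then
    (BState (br_num s).+1 (br_dir s) (br_queue s) (br_pool s) (br_flushed s)
       (upd (br_reducing s) j None)
       (MkSent (br_num s) r [::] [::] false :: br_sent s),
     send_servers
       (Batch (br_num s) (map su_id (re_subs r))
          [seq (re_seq r, su_msg x) | x <- re_subs r]
          [seq (su_id x, su_seq x) | x <- re_stragglers r]))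
  else (s, [::]).

Definition upd_sent (n : nat) (g : sent_batch -> sent_batch) (s : bstate) :=
  BState (br_num s) (br_dir s) (br_queue s) (br_pool s) (br_flushed s)
    (br_reducing s)
    [seq if se_num y == n then g y else y | y <- br_sent s].

Definition broker_recv (b : B) (src : proc) (x : msg) (s : bstate)
    : bstate * seq effect :=
  match src, x with
  | Cl _, Submission a m k sg E =>
      let d := learn (br_dir s) a in
      let validE := if E is Some E' then valid_evidence E' else false in
      let queue :=
        if d a.1 is Some c then
          if (sg == (Cl c, StMessage m k)) &&
             ((k == 0) || (if E is Some E' then validE && (k <= ev_num E')
                           else false))
          then upd (br_queue s) a.1
                 (rcons (br_queue s a.1)
                   (MkSubmission a.1 c m k sg (if validE then E else None)))
          else br_queue s
        else br_queue s in
      (BState (br_num s) d queue (br_pool s) (br_flushed s) (br_reducing s)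
         (br_sent s), [::])
  | Cl c, Reduction ms =>
      (BState (br_num s) (br_dir s) (br_queue s) (br_pool s) (br_flushed s)
         (fun j => omap (fun r =>
            if (ms == ([:: Cl c], StReduction (re_root r))) &&
               (c \in map su_client (re_subs r))
            then MkReducing (re_subs r) (re_seq r) (c :: re_signers r)
            else r) (br_reducing s j))
         (br_sent s), [::])
  | Sv i, BatchAcquired r unknowns =>
      if [seq y <- br_sent s | re_final_root (se_red y) == r] is y :: _ then
        let rd := se_red y in
        (s, [:: Send (Sv i)
               (Signatures r (se_num y) (assignments (br_dir s) unknowns)
                  ([seq Cl (su_client z) | z <- re_subs rd & ~~ re_straggler rd z],
                   StReduction (re_root rd))
                  [seq (su_id z, su_sig z) | z <- re_stragglers rd])])
      else (s, [::])
  | Sv i, WitnessShard ms =>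
      if [seq y <- br_sent s | ms == ([:: Sv i], StWitness (se_key b y))]
        is y :: _ then
        if i \in se_witnesses y then (s, [::]) else
        let ws := i :: se_witnesses y in
        (upd_sent (se_num y)
           (fun z => MkSent (se_num z) (se_red z) ws (se_shards z)
                       (se_completed z)) s,
         if size ws == f + 1 then
           send_servers
             (Witness (re_final_root (se_red y)) (se_num y)
                (map Sv ws, StWitness (se_key b y)))
         else [::])
      else (s, [::])
  | Sv i, CompletionShard k (ps, StCompletion r n) diff =>
      if [seq y <- br_sent s | se_key b y == k] is y :: _ then
        let rd := se_red y in
        let lvs : seq leaf :=
          [seq odflt zl.2 (lookup diff (su_id zl.1))
          | zl <- zip (re_subs rd) (re_final_leaves rd)] in
        if [&& ps == [:: Sv i], r == root_of lvs
             & (i, (lvs, n)) \notin se_shards y] then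
          let shards := (i, (lvs, n)) :: se_shards y in
          let matching := [seq z.1 | z <- shards & z.2 == (lvs, n)] in
          let now := ~~ se_completed y && (f + 1 <= size matching) in
          (upd_sent (se_num y)
             (fun z => MkSent (se_num z) (se_red z) (se_witnesses z) shards
                         (now || se_completed z)) s,
           if now then
             pmap (fun zl : submission * leaf =>
               if zl.2 is Some (_, k'', m) then
                 Some (Send (Cl (su_client zl.1))
                   (Completion r m k'' (prove lvs zl.2) n
                      (map Sv matching, StCompletion r n)))
               else None) (zip (re_subs rd) lvs)
           else [::])
        else (s, [::])
      else (s, [::])
  | _, _ => (s, [::])
  end.

(* [s_last i = None] stands for the initial value (-1, _|_). *)
Record sstate := SState {
  s_dir : dirmap;
  s_batches : key -> option batch;
  s_num : B -> nat;
  s_exp : B -> option root;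
  s_pool : seq key;
  s_last : nat -> option (nat * M);
  s_count : nat;
  s_done : B -> nat;
  s_completed : seq key;
  s_accepts : key -> seq server }.

Definition s_init (d : dirmap) : sstate :=
  SState d (fun _ => None) (fun _ => 1) (fun _ => None) [::] (fun _ => None)
    1 (fun _ => 0) [::] (fun _ => [::]).

Definition set_dir d s := SState d (s_batches s) (s_num s) (s_exp s) (s_pool s)
  (s_last s) (s_count s) (s_done s) (s_completed s) (s_accepts s).
Definition set_batches bs s := SState (s_dir s) bs (s_num s) (s_exp s) (s_pool s)
  (s_last s) (s_count s) (s_done s) (s_completed s) (s_accepts s).
Definition set_exp e s := SState (s_dir s) (s_batches s) (s_num s) e (s_pool s)
  (s_last s) (s_count s) (s_done s) (s_completed s) (s_accepts s).

(* Deletes the batch of [k] once it is completed and accepted by all servers. *)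
Definition collect (k : key) (s : sstate) : sstate :=
  if (k \in s_completed s) && all (fun j => j \in s_accepts s k) servers
  then set_batches (upd (s_batches s) k None) s else s.

(* The checks on the signatures of batch [bt], once all its clients are known. *)
Definition signatures_ok (d : dirmap) (bt : batch) (agg : multisig)
    (ssigs : seq (nat * signature)) : bool :=
  let sids := map fst (b_stragglers bt) in
  let others := [seq Cl c | c <- pmap d [seq j <- b_ids bt | j \notin sids]] in
  [&& all (fun j => j \in map fst ssigs) sids,
      all (fun j => j \in sids) (map fst ssigs),
      all (fun j =>
        match lookup (b_entries bt) j, lookup (b_stragglers bt) j, d j,
              lookup ssigs j with
        | Some (_, m), Some q, Some c, Some sg => sg == (Cl c, StMessage m q)
        | _, _, _, _ => false
        end) sids,
      agg.2 == StReduction (root_of (reduction_leaves bt)),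
      all (fun p => p \in agg.1) others
    & all (fun p => p \in others) agg.1].

Definition server_recv (i : server) (src : proc) (x : msg) (s : sstate)
    : sstate * seq effect :=
  match src, x with
  | Br b, Batch num ids payloads stragglers =>
      let bt := sort_batch (MkBatch (zip ids payloads) stragglers) in
      let r := root_of (batch_leaves bt) in
      let k : key := (r, b, num) in
      if [&& ~~ isSome (s_batches s k), num == s_num s b,
             ~~ isSome (s_exp s b), uniq ids & size ids == size payloads]
      then (set_exp (upd (s_exp s) b (Some r))
              (set_batches (upd (s_batches s) k (Some bt)) s),
            [:: Send (Br b)
              (BatchAcquired r [seq j <- b_ids bt | ~~ isSome (s_dir s j)])])
      else (s, [::])
  | Br b, Signatures r num assigns agg ssigs =>
      let d := learn_all (s_dir s) assigns in
      let k : key := (r, b, num) in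
      (set_dir d s,
       if s_batches s k is Some bt then
         if [&& s_exp s b == Some r, num == s_num s b,
                all (fun j => isSome (d j)) (b_ids bt)
              & signatures_ok d bt agg ssigs]
         then [:: MultiSign (StWitness k);
                  Send (Br b) (WitnessShard ([:: Sv i], StWitness k))]
         else [::]
       else [::])
  | Br b, Witness r num W =>
      (s, if [&& s_exp s b == Some r, num == s_num s b
               & certified (StWitness (r, b, num)) W]
          then [:: StobBroadcast (b, r, W)] else [::])
  | Sv j, RequestBatch k =>
      (s, if s_batches s k is Some bt
          then [:: Send (Sv j) (BatchReply k bt (assignments (s_dir s) (b_ids bt)))]
          else [::])
  | Sv _, BatchReply k bt assigns =>
      if (k \in s_pool s) && ~~ isSome (s_batches s k) then
        let d := learn_all (s_dir s) assigns in
        let bt' := sort_batch bt in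
        (if all (fun j => isSome (d j)) (b_ids bt') &&
            (root_of (batch_leaves bt') == k.1.1)
         then set_batches (upd (s_batches s) k (Some bt')) (set_dir d s)
         else set_dir d s, [::])
      else (s, [::])
  | Sv j, Collection k =>
      (s, if k.2 <= s_done s k.1.2 then [:: Send (Sv j) (CollectionAccept k)]
          else [::])
  | Sv j, CollectionAccept k =>
      (collect k
         (SState (s_dir s) (s_batches s) (s_num s) (s_exp s) (s_pool s)
            (s_last s) (s_count s) (s_done s) (s_completed s)
            (upd (s_accepts s) k (j :: s_accepts s k))), [::])
  | _, _ => (s, [::])
  end.

Definition server_stob (x : smsg) (s : sstate) : sstate * seq effect :=
  let: (b, r, W) := x in
  let k : key := (r, b, s_num s b) in
  if certified (StWitness k) W then
    (SState (s_dir s) (s_batches s) (upd (s_num s) b (s_num s b).+1)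
       (if s_exp s b == Some r then upd (s_exp s) b None else s_exp s)
       (rcons (s_pool s) k)
       (s_last s) (s_count s) (s_done s) (s_completed s) (s_accepts s),
     if s_exp s b == Some r then [::] else send_servers (RequestBatch k))
  else (s, [::]).

(* Returns the new [last], the completion leaves and the delivered messages. *)
Fixpoint complete_entries (d : dirmap) (bt : batch)
    (last : nat -> option (nat * M)) (es : seq (nat * (nat * M)))
    : (nat -> option (nat * M)) * seq leaf * seq (option C * M) :=
  if es is e :: es' then
    let id := e.1 in
    let m := e.2.2 in
    let q := b_seqno bt e in
    let skip (l : leaf) :=
      let: (last', ls, ds) := complete_entries d bt last es' in
      (last', l :: ls, ds) in
    let deliver :=
      let: (last', ls, ds) :=
        complete_entries d bt (upd last id (Some (q, m))) es' in
      (last', Some (id, q, m) :: ls, (d id, m) :: ds) in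
    if last id is Some (q', m') then
      if q < q' then skip None
      else if m == m' then skip (Some (id, q', m'))
      else if q' < q then deliver
      else skip None
    else deliver
  else (last, [::], [::]).

Definition server_complete (i : server) (s : sstate) : sstate * seq effect :=
  if s_pool s is k :: pool' then
    if s_batches s k is Some bt then
      let b := k.1.2 in
      let: (last', ls, ds) :=
        complete_entries (s_dir s) bt (s_last s) (b_entries bt) in
      let st := StCompletion (root_of ls) (s_count s) in
      let diff := [seq (x.1, x.2.1)
                  | x <- zip (b_ids bt) (zip ls (batch_leaves bt))
                  & x.2.1 != x.2.2] in
      (collect k
         (SState (s_dir s) (s_batches s) (s_num s) (s_exp s) pool' last'
            (s_count s).+1 (upd (s_done s) b (s_done s b).+1)
            (k :: s_completed s) (s_accepts s)),
       [seq Deliver x.1 x.2 | x <- ds]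
       ++ [:: MultiSign st;
              Send (Br b) (CompletionShard k ([:: Sv i], st) diff)]
       ++ send_servers (Collection k))
    else (s, [::])
  else (s, [::]).

Record packet := Packet { pk_src : proc; pk_dst : proc; pk_msg : msg }.

(* [w_net] is the list of all packets ever sent and [w_received] the positions
   of those already received; [w_signed], [w_multisigned] and [w_stob] record
   every signature, multi-signature and STOB broadcast so far; [w_log i] lists
   the STOB deliveries of server i, oldest first.  The local states of Byzantine
   processes are never used. *)
Record world := World {
  w_clients : C -> cstate;
  w_brokers : B -> bstate;
  w_servers : server -> sstate;
  w_net : seq packet;
  w_received : seq nat;
  w_signed : seq (proc * stmt);
  w_multisigned : seq (proc * stmt);
  w_stob : seq (proc * smsg);
  w_log : server -> seq smsg }.

(* The local directories may initially hold any part of the directory. *)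
Definition initial (w : world) : Prop :=
  exists (bd : B -> dirmap) (sd : server -> dirmap),
    [/\ forall b, sound_dir (bd b), forall i, sound_dir (sd i)
      & w = World (fun _ => c_init) (fun b => b_init (bd b))
              (fun i => s_init (sd i)) [::] [::] [::] [::] [::] (fun _ => [::])].

Definition set_client c s w :=
  World (upd (w_clients w) c s) (w_brokers w) (w_servers w) (w_net w)
    (w_received w) (w_signed w) (w_multisigned w) (w_stob w) (w_log w).
Definition set_broker b s w :=
  World (w_clients w) (upd (w_brokers w) b s) (w_servers w) (w_net w)
    (w_received w) (w_signed w) (w_multisigned w) (w_stob w) (w_log w).
Definition set_server i s w :=
  World (w_clients w) (w_brokers w) (upd (w_servers w) i s) (w_net w)
    (w_received w) (w_signed w) (w_multisigned w) (w_stob w) (w_log w).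
Definition set_received js w :=
  World (w_clients w) (w_brokers w) (w_servers w) (w_net w)
    js (w_signed w) (w_multisigned w) (w_stob w) (w_log w).
Definition set_log l w :=
  World (w_clients w) (w_brokers w) (w_servers w) (w_net w)
    (w_received w) (w_signed w) (w_multisigned w) (w_stob w) l.

Definition emit (p : proc) (fx : seq effect) (w : world) : world :=
  World (w_clients w) (w_brokers w) (w_servers w)
    (w_net w ++ [seq Packet p x.1 x.2 | x <- sends fx])
    (w_received w)
    (w_signed w ++ map (pair p) (signs fx))
    (w_multisigned w ++ map (pair p) (multisigns fx))
    (w_stob w ++ map (pair p) (stob_broadcasts fx))
    (w_log w).

Definition act_client c (g : cstate -> cstate * seq effect) (w : world) :=
  let: (s, fx) := g (w_clients w c) in emit (Cl c) fx (set_client c s w).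
Definition act_broker b (g : bstate -> bstate * seq effect) (w : world) :=
  let: (s, fx) := g (w_brokers w b) in emit (Br b) fx (set_broker b s w).
Definition act_server i (g : sstate -> sstate * seq effect) (w : world) :=
  let: (s, fx) := g (w_servers w i) in emit (Sv i) fx (set_server i s w).

(* Unforgeability: a signature of a correct process exists only once that
   process has produced it. *)
Definition authentic_sig (w : world) (sg : signature) : bool :=
  byz sg.1 || (sg \in w_signed w).
Definition authentic_msig (w : world) (ms : multisig) : bool :=
  all (fun p => byz p || ((p, ms.2) \in w_multisigned w)) ms.1.
Definition authentic (w : world) (x : msg) : bool :=
  all (authentic_sig w) (sigs_in x) && all (authentic_msig w) (msigs_in x).

Inductive action :=
  | Idle
  | ByzSend (p q : proc) (x : msg)
  | ByzStob (i : server) (x : smsg)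
  | Receive (j : nat)
  | ClBroadcast (c : C) (m : M) (b : B)
  | ClTimer (c : C) (m : M) (ob : option B)
  | BrPool (b : B) (i : nat)
  | BrFlush (b : B)
  | BrSend (b : B) (j : nat)
  | StobDeliver (i : server) (x : smsg)
  | SvComplete (i : server).

(* Rule BR1: all correct servers have delivered the batch that b sent last. *)
Definition may_send (w : world) (b : B) : Prop :=
  if br_sent (w_brokers w b) is y :: _ then
    forall i, correct (Sv i) ->
      exists2 W, (b, re_final_root (se_red y), W) \in w_log w i
               & certified (StWitness (se_key b y)) W
  else True.

(* In [ClBroadcast], the two conditions after [correct] are rules CR1 and CR2. *)
Definition enabled (w : world) (a : action) : Prop :=
  match a with
  | Idle => True
  | ByzSend p _ x => byz p /\ authentic w x
  | ByzStob i x => byz (Sv i) /\ authentic_msig w x.2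
  | Receive j =>
      j \notin w_received w /\
      exists2 pk, onth (w_net w) j = Some pk & correct (pk_dst pk)
  | ClBroadcast c m b =>
      [/\ correct (Cl c), c_pending (w_clients w c) = [::]
        & c_last (w_clients w c) <> Some m]
  | ClTimer c m ob =>
      let s := w_clients w c in
      [/\ correct (Cl c), m \in c_timers s
        & if ob is Some b then
            is_true ((m \in c_pending s) && (b \notin c_tried s m))
          else m \in c_pending s -> forall b, b \in c_tried s m]
  | BrPool b i =>
      let s := w_brokers w b in
      [/\ correct (Br b), 0 < size (br_queue s i)
        & i \notin map su_id (br_pool s)]
  | BrFlush b => correct (Br b) /\ 0 < size (br_pool (w_brokers w b))
  | BrSend b j =>
      [/\ correct (Br b), isSome (br_reducing (w_brokers w b) j)
        & may_send w b]
  | StobDeliver i _ => correct (Sv i)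
  | SvComplete i =>
      correct (Sv i) /\
      exists k pool', s_pool (w_servers w i) = k :: pool' /\
        isSome (s_batches (w_servers w i) k)
  end.

Definition receive (pk : packet) (w : world) : world :=
  let: Packet src dst x := pk in
  match dst with
  | Cl c => act_client c (client_recv c src x) w
  | Br b => act_broker b (broker_recv b src x) w
  | Sv i => act_server i (server_recv i src x) w
  end.

Definition run (a : action) (w : world) : world :=
  match a with
  | Idle => w
  | ByzSend p q x => emit p [:: Send q x] w
  | ByzStob i x => emit (Sv i) [:: StobBroadcast x] w
  | Receive j =>
      if onth (w_net w) j is Some pk
      then receive pk (set_received (j :: w_received w) w) else w
  | ClBroadcast c m b => act_client c (client_broadcast c m b) w
  | ClTimer c m ob => act_client c (client_timer c m ob) w
  | BrPool b i => set_broker b (broker_pool i (w_brokers w b)) w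
  | BrFlush b => act_broker b broker_flush w
  | BrSend b j => act_broker b (broker_send j) w
  | StobDeliver i x =>
      act_server i (server_stob x)
        (set_log (upd (w_log w) i (rcons (w_log w i) x)) w)
  | SvComplete i => act_server i (server_complete i) w
  end.

Section Runs.
Variables (tr : nat -> world) (act : nat -> action).

(* For total order, [index x l < index y l] says that x occurs in l, and that y
   does not occur before it. *)
Record stob_spec : Prop := StobSpec {
  stob_no_duplication : forall t i j x, correct (Sv i) -> correct (Sv j) ->
    (Sv j, x) \in w_stob (tr t) -> count_mem x (w_log (tr t) i) <= 1;
  stob_integrity : forall t i x, correct (Sv i) ->
    x \in w_log (tr t) i -> exists j : server, (Sv j, x) \in w_stob (tr t);
  stob_validity : forall t j x, correct (Sv j) ->
    (Sv j, x) \in w_stob (tr t) ->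
    exists t' i, correct (Sv i) /\ x \in w_log (tr t') i;
  stob_agreement : forall t i j x, correct (Sv i) -> correct (Sv j) ->
    x \in w_log (tr t) i -> exists t', x \in w_log (tr t') j;
  stob_total_order : forall t i j x y, correct (Sv i) -> correct (Sv j) ->
    x != y -> index x (w_log (tr t) i) < index y (w_log (tr t) i) ->
    ~~ (index y (w_log (tr t) j) < index x (w_log (tr t) j))
}.

(* Reliable links, finite timers, and progress of the internal actions.  The
   sending of a batch may moreover have to wait for rule BR1. *)
Record fairness : Prop := Fairness {
  fair_links : forall t j pk, onth (w_net (tr t)) j = Some pk ->
    correct (pk_src pk) -> correct (pk_dst pk) ->
    exists t', act t' = Receive j;
  fair_client_timer : forall t c m, correct (Cl c) ->
    m \in c_timers (w_clients (tr t) c) ->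
    exists2 t', t <= t' & exists ob, act t' = ClTimer c m ob;
  fair_pooling : forall t b i, correct (Br b) ->
    0 < size (br_queue (w_brokers (tr t) b) i) ->
    exists2 t', t <= t' & act t' = BrPool b i;
  fair_pool_timer : forall t b, correct (Br b) ->
    0 < size (br_pool (w_brokers (tr t) b)) ->
    exists2 t', t <= t' & act t' = BrFlush b;
  fair_reduction_timer : forall t b j, correct (Br b) ->
    isSome (br_reducing (w_brokers (tr t) b) j) ->
    (exists2 t', t <= t' & act t' = BrSend b j) \/
    (exists t0, forall t', t0 <= t' -> ~ may_send (tr t') b);
  fair_completion : forall t i k pool', correct (Sv i) ->
    s_pool (w_servers (tr t) i) = k :: pool' ->
    isSome (s_batches (w_servers (tr t) i) k) ->
    exists2 t', t <= t' & act t' = SvComplete i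
}.

Record execution : Prop := Execution {
  exec_initial : initial (tr 0);
  exec_enabled : forall t, enabled (tr t) (act t);
  exec_step : forall t, tr t.+1 = run (act t) (tr t);
  exec_stob : stob_spec;
  exec_fair : fairness
}.

(* At time t, client c triggers Broadcast(m). *)
Definition broadcasts (t : nat) (c : C) (m : M) : Prop :=
  exists b, act t = ClBroadcast c m b.

(* At time t, server i triggers Deliver(c, m). *)
Definition delivers (t : nat) (i : server) (c : C) (m : M) : Prop :=
  act t = SvComplete i /\
  (Some c, m) \in deliveries (server_complete i (w_servers (tr t) i)).2.

End Runs.

End Protocol.

(* Submission.v *)
Require Import Defs.
From mathcomp Require Import all_boot.

(** A batch is delivered only after f+1 servers, hence a correct one, have
    multi-signed a witness for its root.  That correct server held leaves with
    this root and distinct identifiers, and checked, for each leaf of a correct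
    client c, either a signature of c on the message or a multi-signature of c
    on a root of which (id of c, k, message) is the only leaf with the
    identifier of c.  A correct client produces either only for a message that
    it has broadcast.  Collision-freeness carries this over to the delivering
    server, which may have obtained the batch from anyone.  Since the
    model constrains only what Byzantine processes send, the invariant must also
    say that the tokens stored and forwarded by correct processes are authentic. *)

Set Implicit Arguments.
Unset Strict Implicit.
Unset Printing Implicit Defensive.

(** * Association lists and filtered lists *)

Lemma lookup_mem (T : eqType) (al : seq (nat * T)) i x :
  lookup al i = Some x -> (i, x) \in al.
Proof.
elim: al => //= -[j y] al IH; case: eqP => [-> [->]|_ /IH h].
  exact: mem_head.
by rewrite inE h orbT.
Qed.

Lemma lookup_uniq (T : eqType) (al : seq (nat * T)) e :
  uniq (map fst al) -> e \in al -> lookup al e.1 = Some e.2.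
Proof.
elim: al => //= -[j y] al IH /= /andP[jal ual]; rewrite inE.
case/predU1P=> [-> /=|eal]; first by rewrite eqxx.
case: eqP => [je|_]; last exact: IH.
by rewrite je (map_f fst eal) in jal.
Qed.

Lemma all_filter_cons (T : Type) (a p : pred T) s x s' :
  [seq y <- s | a y] = x :: s' -> all p s -> a x /\ p x.
Proof.
elim: s => //= y s IH; case: ifP => [ay [yx _] /andP[py _]|_ h /andP[_ /IH]].
  by rewrite -yx.
exact.
Qed.

Lemma filter_cons_map (T : Type) (U : eqType) (h : T -> U) (a : pred T) s x s' :
  [seq y <- s | a y] = x :: s' -> h x \in map h s.
Proof.
elim: s => //= y s IH; case: ifP => [_ [-> _]|_ /IH IHs]; first exact: mem_head.
by rewrite inE IHs orbT.
Qed.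

Section Invariant.
Variables (M C B : eqType) (f : nat) (id_of : C -> nat) (H : merkle (leaf M)).
Variable byz : pred (proc C B f).
Hypothesis id_of_inj : injective id_of.
Hypothesis byz_servers : #|[set i : server f | byz (Sv i)]| <= f.

Notation root := (mk_root H).
Notation root_of := (@root_of (leaf M) H).
Notation verify := (@verify (leaf M) H).
Notation server := (server f).
Notation proc := (proc C B f).
Notation world := (world C B f H).
Notation stmt := (stmt B H).
Notation msg := (msg C B f H).
Notation effect := (effect C B f H).
Notation cstate := (cstate C B f H).
Notation bstate := (bstate C B f H).
Notation sstate := (sstate C B f H).
Notation submission := (submission C B f H).
Notation reducing := (reducing C B f H).
Notation sent_batch := (sent_batch C B f H).
Notation evidence := (evidence C B f H).
Notation correct := (correct byz).
Notation authentic_sig := (authentic_sig byz).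
Notation authentic_msig := (authentic_msig byz).
Notation authentic := (authentic byz).

(** * Authenticity of the tokens held by clients and brokers *)

Definition evidence_ok (w : world) (E : option evidence) : bool :=
  all (authentic_msig w) (ev_msigs E).

Definition submission_ok (w : world) (x : submission) : bool :=
  authentic_sig w (su_sig x) && evidence_ok w (su_ev x).

Definition reducing_ok (w : world) (r : reducing) : bool :=
  all (submission_ok w) (re_subs r) &&
  all (fun c => authentic_msig w ([:: Cl c], StReduction B (re_root r)))
    (re_signers r).

(** A sent batch stores signers, not tokens. The tokens tested here are those from which the broker
    later assembles its witness and completion certificates. *)
Definition sent_ok (w : world) (b : B) (y : sent_batch) : bool :=
  [&& reducing_ok w (se_red y),
      all (fun i => authentic_msig w ([:: Sv i], StWitness (se_key b y)))
        (se_witnesses y)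
    & all (fun z : server * (seq (leaf M) * nat) =>
        authentic_msig w ([:: Sv z.1], StCompletion B (root_of z.2.1) z.2.2))
        (se_shards y)].

(* Witnesses are added to all sent batches with a given number but signed for
   one key, whence the uniqueness of the numbers. *)
Record broker_ok (w : world) (b : B) (s : bstate) : Prop := BrokerOk {
  bo_queue : forall i, all (submission_ok w) (br_queue s i);
  bo_pool : all (submission_ok w) (br_pool s);
  bo_reducing : forall j r, br_reducing s j = Some r -> reducing_ok w r;
  bo_sent : all (sent_ok w b) (br_sent s);
  bo_uniq : uniq (map (@se_num _ _ _ _ _) (br_sent s));
  bo_num : all (fun n => n < br_num s) (map (@se_num _ _ _ _ _) (br_sent s)) }.

(** * Monotonicity of authenticity as signatures accumulate *)

Definition le_world (w w' : world) : Prop :=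
  {subset w_signed w <= w_signed w'} /\
  {subset w_multisigned w <= w_multisigned w'}.

Lemma le_emit p fx (w : world) : le_world w (emit p fx w).
Proof. by split=> x hx; rewrite mem_cat hx. Qed.

Section Mono.
Variables (w w' : world) (ww' : le_world w w').

Lemma authentic_sig_mono : subpred (authentic_sig w) (authentic_sig w').
Proof.
by move=> sg; case/orP=> [h|/ww'.1 h]; apply/orP; [left|right].
Qed.

Lemma authentic_msig_mono : subpred (authentic_msig w) (authentic_msig w').
Proof.
move=> ms; apply: sub_all => p.
by case/orP=> [->|/ww'.2 ->] //; rewrite orbT.
Qed.

Lemma authentic_mono : subpred (authentic w) (authentic w').
Proof.
move=> x /andP[h1 h2]; apply/andP; split.
  exact: sub_all authentic_sig_mono _ h1.
exact: sub_all authentic_msig_mono _ h2.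
Qed.

Lemma evidence_ok_mono : subpred (evidence_ok w) (evidence_ok w').
Proof. by move=> E; apply: sub_all authentic_msig_mono _. Qed.

Lemma submission_ok_mono : subpred (submission_ok w) (submission_ok w').
Proof.
by move=> x /andP[/authentic_sig_mono h /evidence_ok_mono h']; apply/andP.
Qed.

Lemma reducing_ok_mono : subpred (reducing_ok w) (reducing_ok w').
Proof.
move=> r /andP[h1 h2]; apply/andP; split.
  exact: sub_all submission_ok_mono _ h1.
by apply: sub_all h2 => c; apply: authentic_msig_mono.
Qed.

Lemma sent_ok_mono b : subpred (sent_ok w b) (sent_ok w' b).
Proof.
move=> y /and3P[h1 h2 h3]; apply/and3P; split.
- exact: reducing_ok_mono.
- by apply: sub_all h2 => i; apply: authentic_msig_mono.
- by apply: sub_all h3 => i; apply: authentic_msig_mono.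
Qed.

Lemma broker_ok_mono b s : broker_ok w b s -> broker_ok w' b s.
Proof.
case=> h1 h2 h3 h4 h5 h6; split=> //.
- by move=> i; apply: sub_all submission_ok_mono _ (h1 i).
- exact: sub_all submission_ok_mono _ h2.
- by move=> j r /h3 /reducing_ok_mono.
- exact: sub_all (@sent_ok_mono b) _ h4.
Qed.

End Mono.

(** * The invariant *)

Variable sent : C -> M -> Prop.

(** The property is attached to the root, not to a stored batch, so that it passes from the
    witnessing server to any server holding leaves with this root. It is vacuous for a root that
    comes from no list. *)
Definition good_root (r : root) : Prop :=
  forall ls id q m c, r = root_of ls -> Some (id, q, m) \in ls ->
    correct (Cl c) -> id_of c = id -> sent c m.

Definition signed_ok (p : proc) (s : stmt) : Prop :=
  match p, s with
  | Cl c, StMessage m _ => sent c m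
  | _, _ => True
  end.

(** A client that signs a reduction has seen only an inclusion proof, and the root may come from a
    Byzantine broker; hence a verified leaf here instead of a list of leaves. *)
Definition multisigned_ok (p : proc) (s : stmt) : Prop :=
  match p, s with
  | Cl c, StReduction r =>
      exists m k pf, verify r (Some (id_of c, k, m)) pf /\ sent c m
  | Sv _, StWitness k => good_root k.1.1
  | _, _ => True
  end.

Definition client_ok (w : world) (c : C) (s : cstate) : Prop :=
  (forall m, m \in c_pending s -> sent c m) /\ evidence_ok w (c_ev s).

(* Uniqueness of the identifiers is lost for the batches obtained from other
   servers, but these have already been ordered, so that no witness shard will
   be sent for them. *)
Record server_ok (s : sstate) : Prop := ServerOk {
  so_dir : sound_dir id_of (s_dir s);
  so_root : forall k bt, s_batches s k = Some bt ->
    k.1.1 = root_of (batch_leaves bt);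
  so_uniq : forall k bt, s_batches s k = Some bt -> s_num s k.1.2 <= k.2 ->
    uniq (b_ids bt);
  so_pool : forall k, k \in s_pool s ->
    k.2 < s_num s k.1.2 /\ good_root k.1.1 }.

Record inv (w : world) : Prop := Inv {
  inv_clients : forall c, client_ok w c (w_clients w c);
  inv_brokers : forall b, broker_ok w b (w_brokers w b);
  inv_servers : forall i, server_ok (w_servers w i);
  inv_net : all (fun pk => authentic w (pk_msg pk)) (w_net w);
  inv_stob : forall p x, (p, x) \in w_stob w -> authentic_msig w x.2;
  inv_signed : forall p s, (p, s) \in w_signed w -> signed_ok p s;
  inv_multisigned : forall p s, (p, s) \in w_multisigned w ->
    multisigned_ok p s }.

(** * Effects of a handler *)

Definition effect_ok (w : world) (e : effect) : bool :=
  match e with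
  | Send _ x => authentic w x
  | StobBroadcast x => authentic_msig w x.2
  | _ => true
  end.

(** Authenticity is tested after the emission, because a message may carry a token that its sender
    produces in the same step. *)
Definition effects_ok (p : proc) (w : world) (fx : seq effect) : Prop :=
  [/\ all (effect_ok (emit p fx w)) fx,
      forall s, s \in signs fx -> signed_ok p s
    & forall s, s \in multisigns fx -> multisigned_ok p s].

Definition unsigned (e : effect) : bool :=
  match e with Sign _ | MultiSign _ => false | _ => true end.

Lemma signs_unsigned fx : all unsigned fx -> signs fx = [::].
Proof. by elim: fx => //= -[] //= ? ? IH; move=> *; apply: IH. Qed.

Lemma multisigns_unsigned fx : all unsigned fx -> multisigns fx = [::].
Proof. by elim: fx => //= -[] //= ? ? IH; move=> *; apply: IH. Qed.

Lemma effects_ok_unsigned p (w : world) fx :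
  all unsigned fx -> all (effect_ok w) fx -> effects_ok p w fx.
Proof.
move=> nofx okfx; split.
- apply: sub_all okfx => -[q x|s|s|x|oc m] //=.
    exact/authentic_mono/le_emit.
  exact/authentic_msig_mono/le_emit.
- by rewrite signs_unsigned.
- by rewrite multisigns_unsigned.
Qed.

Lemma effects_sends (w : world) fx :
  all (effect_ok w) fx -> all (fun x => authentic w x.2) (sends fx).
Proof.
by elim: fx => //= e fx IH /andP[we /IH]; case: e we => //= q x ->.
Qed.

Lemma effects_stob (w : world) fx x :
  all (effect_ok w) fx -> x \in stob_broadcasts fx -> authentic_msig w x.2.
Proof.
elim: fx => //= e fx IH /andP[we /IH {}IH].
case: e we => [q y|s|s|y|oc m] //= wy.
by rewrite inE => /predU1P[->|/IH].
Qed.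

(** Here [w0] is [w] with some local state replaced. Both have the same signature records, so local
    conditions may be checked in [w] and carried by monotonicity to the world after the emission. *)
Lemma inv_emit p fx (w w0 : world) :
  inv w -> effects_ok p w fx ->
  (forall c, client_ok w c (w_clients w0 c)) ->
  (forall b, broker_ok w b (w_brokers w0 b)) ->
  (forall i, server_ok (w_servers w0 i)) ->
  w_net w0 = w_net w -> w_signed w0 = w_signed w ->
  w_multisigned w0 = w_multisigned w -> w_stob w0 = w_stob w ->
  inv (emit p fx w0).
Proof.
move=> [_ _ _ netw stw sgw msw] [fxok sgok msok] clok brok svok e1 e2 e3 e4.
have ww' : le_world w (emit p fx w0).
  by rewrite /le_world /= e2 e3; split=> ? h; rewrite mem_cat h.
have fxok' : all (effect_ok (emit p fx w0)) fx.
  apply: sub_all fxok; have ee : le_world (emit p fx w) (emit p fx w0).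
    by rewrite /le_world /= e2 e3; split=> ?.
  case=> [q x|s|s|x|oc m] //=; first exact: authentic_mono.
  exact: authentic_msig_mono.
split=> //=.
- by move=> c; have [h1 h2] := clok c; split=> //; apply: evidence_ok_mono h2.
- by move=> b; apply: broker_ok_mono (brok b).
- rewrite all_cat e1; apply/andP; split.
    by apply: sub_all netw => pk; apply: authentic_mono.
  by rewrite all_map; apply: effects_sends.
- move=> q x; rewrite e4 mem_cat => /orP[/stw|].
    exact: authentic_msig_mono.
  by case/mapP=> y + [_ ->]; apply: effects_stob.
- move=> q s; rewrite e2 mem_cat => /orP[/sgw//|/mapP[s' hs [-> ->]]].
  exact: sgok.
- move=> q s; rewrite e3 mem_cat => /orP[/msw//|/mapP[s' hs [-> ->]]].
  exact: msok.
Qed.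

Lemma effects_ok0 p (w : world) : effects_ok p w [::].
Proof. exact: effects_ok_unsigned. Qed.

(** * Client handlers *)

Lemma client_submit_ok (w : world) c m b (s : cstate) :
  client_ok w c s -> sent c m ->
  client_ok w c (client_submit id_of c m b s).1 /\
  effects_ok (Cl c) w (client_submit id_of c m b s).2.
Proof.
move=> [pend ev] cm; split=> //; split=> //=; last first.
  by move=> st; rewrite inE => /eqP ->.
have := evidence_ok_mono (le_emit (Cl c) (client_submit id_of c m b s).2 w) ev.
rewrite /evidence_ok /authentic /= => ->.
by rewrite /authentic_sig /= mem_cat inE eqxx !orbT.
Qed.

Lemma client_recv_ok (w : world) c src x (s : cstate) :
  client_ok w c s -> authentic w x ->
  client_ok w c (client_recv id_of c src x s).1 /\
  effects_ok (Cl c) w (client_recv id_of c src x s).2.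
Proof.
move=> ok; have [pend ev] := ok; have fx0 := effects_ok0 (Cl c) w.
case: src => [c'|b|i] //.
case: x => // [m rt pf k [E|]|r m k pf n cert] /= auth //.
  case: ifP => // /and5P[pm _ vf _ _]; split=> //.
  split=> //=; last first.
    (* The witnesses are the contents of the [Inclusion] message: its proof has just been verified,
       and its message is pending, hence sent. *)
    move=> st; rewrite inE => /eqP ->; exists m, k, pf.
    by split=> //; apply: pend.
  rewrite andbT /authentic /= /authentic_msig /= mem_cat inE eqxx.
  by rewrite !orbT.
case: ifP => // _.
have ev' : evidence_ok w (if (if c_ev s is Some E then ev_num E < n else true)
    then Some (Evidence r n cert) else c_ev s).
  by case: ifP => // _; rewrite /evidence_ok /=; case/andP: auth.
case: ifP => _ //=; split=> //; split=> //= m'.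
by rewrite mem_filter => /andP[_ /pend].
Qed.

(** * Broker handlers *)

Lemma best_evidence_ok (w : world) xs :
  all (submission_ok w) xs -> evidence_ok w (best_evidence xs).
Proof.
elim: xs => //= x xs IH /andP[/andP[_ xok] /IH].
case: (su_ev x) xok => // E Eok; case: (best_evidence xs) => // E' E'ok.
by case: ifP.
Qed.

Lemma send_servers_ok (w : world) x :
  all (effect_ok w) (send_servers x) = (authentic w x).
Proof.
rewrite all_map; apply/idP/idP => [/allP h|h]; last exact/allP.
(* The direct implication needs at least one server among the recipients. *)
have i0 : 0 < 3 * f + 1 by rewrite addn1.
by apply: (h (Ordinal i0)); rewrite mem_enum.
Qed.

Lemma send_servers_unsigned x : all unsigned (send_servers x : seq effect).
Proof. by rewrite all_map; apply/allP. Qed.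

Lemma broker_pool_ok (w : world) b i (s : bstate) :
  broker_ok w b s -> broker_ok w b (broker_pool i s).
Proof.
case=> h1 h2 h3 h4 h5 h6; rewrite /broker_pool.
case e: (br_queue s i) => [|x q]; split=> //=.
  move=> j; rewrite /upd; case: ifP => // _.
  by have := h1 i; rewrite e => /andP[].
by have := h1 i; rewrite e all_rcons => /andP[-> _].
Qed.

Lemma broker_flush_ok (w : world) b (s : bstate) :
  broker_ok w b s ->
  broker_ok w b (broker_flush s).1 /\ effects_ok (Br b) w (broker_flush s).2.
Proof.
case=> h1 h2 h3 h4 h5 h6; split.
  split=> //= j r; rewrite /upd; case: ifP => [_ [<-]|_ /h3 //].
  by rewrite /reducing_ok /= all_sort h2.
rewrite /broker_flush /=; set subs := sort _ _.
have subs_ok : all (submission_ok w) subs by rewrite all_sort.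
apply: effects_ok_unsigned; rewrite all_map.
  by elim: (subs).
have := best_evidence_ok subs_ok; rewrite /evidence_ok => evok.
by rewrite (eq_all (a2 := predT)) ?all_predT.
Qed.

Lemma broker_send_ok (w : world) b j (s : bstate) :
  broker_ok w b s ->
  broker_ok w b (broker_send j s).1 /\ effects_ok (Br b) w (broker_send j s).2.
Proof.
move=> ok; have [h1 h2 h3 h4 h5 h6] := ok; rewrite /broker_send.
case e: (br_reducing s j) => [r|]; last by split; [exact: ok|exact: effects_ok0].
split; last by apply: effects_ok_unsigned;
    rewrite ?send_servers_unsigned ?send_servers_ok.
split=> //=.
- by move=> j' r'; rewrite /upd; case: ifP => // _ /h3.
- by rewrite h4 /sent_ok /= (h3 _ _ e).
- rewrite h5 andbT; apply/negP => /(allP h6); by rewrite ltnn.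
- by rewrite ltnSn /=; apply: sub_all h6 => n /ltnW.
Qed.

(** Handlers pick [y] as the first match of a filter, but update every batch with its number.
    Numbers being distinct, the update reaches [y] alone, and only [g y] has to be checked. *)
Lemma upd_sent_ok (w : world) b (s : bstate) (a : pred sent_batch) y s' g :
  broker_ok w b s -> [seq z <- br_sent s | a z] = y :: s' ->
  (forall z, se_num (g z) = se_num z) -> sent_ok w b (g y) ->
  broker_ok w b (upd_sent (se_num y) g s).
Proof.
case=> h1 h2 h3 h4 h5 h6 ey gnum yok; rewrite /upd_sent.
have enum l : map (@se_num _ _ _ _ _) [seq if se_num z == se_num y
    then g z else z | z <- l] = map (@se_num _ _ _ _ _) l.
  by rewrite -map_comp; apply: eq_map => z /=; case: ifP.
split=> //=; rewrite ?enum //.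
elim: (br_sent s) h4 h5 ey {h6} => //= z l IH /andP[zok lok] /andP[zl ul].
case: ifP => [_ [zy _]|_ ey]; last first.
  case: eqP => [zy|_]; last by rewrite zok; apply: IH.
  by rewrite zy (filter_cons_map _ ey) in zl.
rewrite -{}zy in yok *; rewrite eqxx yok /=.
elim: l zl lok {IH ul} => //= x l IH; rewrite inE negb_or => /andP[zx zl].
by rewrite eq_sym (negPf zx) => /andP[-> /(IH zl)].
Qed.

Lemma authentic_aggregate (w : world) (T : Type) (g : T -> proc) st ps :
  authentic_msig w (map g ps, st) =
  all (fun i => authentic_msig w ([:: g i], st)) ps.
Proof.
by rewrite /authentic_msig all_map; apply: eq_all => i; rewrite /= andbT.
Qed.

Lemma broker_recv_ok (w : world) b src x (s : bstate) :
  broker_ok w b s -> authentic w x ->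
  broker_ok w b (broker_recv id_of b src x s).1 /\
  effects_ok (Br b) w (broker_recv id_of b src x s).2.
Proof.
move=> ok; have [h1 h2 h3 h4 h5 h6] := ok; have fx0 := effects_ok0 (Br b) w.
case: src => [c|b'|i] //; last 1 first.
- case: x => [|||||r unknowns||ms||k [ps [| | |r n]] diff||||] auth //;
    rewrite /broker_recv.
  + case e: [seq y <- _ | _] => [|y s'] //=; split=> //.
    have [_ /and3P[/andP[subok sigok] _ _]] := all_filter_cons e h4.
    apply: effects_ok_unsigned => //=; rewrite andbT /authentic /=.
    apply/and3P; split=> //.
      rewrite -map_comp all_map all_filter; apply: sub_all subok.
      move=> z /andP[h _].
      by apply/implyP.
    rewrite map_comp authentic_aggregate all_map all_filter.
    (* The aggregate ranges over the clients that are not stragglers, which by definition are among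
       the recorded signers. *)
    elim: (re_subs _) => //= z l ->; rewrite andbT; apply/implyP.
    by rewrite /re_straggler negbK => /(allP sigok).
  + case e: [seq y <- _ | _] => [|y s'] //=; case: ifP => //= _.
    have [/eqP ems /and3P[rok wok shok]] := all_filter_cons e h4.
    move: auth; rewrite ems /authentic /= andbT => auth.
    split.
      by apply: (upd_sent_ok ok e) => //; rewrite /sent_ok /= rok shok auth wok.
    case: ifP => // _; apply: effects_ok_unsigned; rewrite ?send_servers_unsigned //.
    rewrite send_servers_ok /authentic /= andbT.
    by rewrite -(map_cons Sv) authentic_aggregate /= auth.
  + case e: [seq y <- _ | _] => [|y s'] //; cbv zeta.
    set lvs := [seq odflt _ _ | zl <- _].
    case: ifP => // /and3P[/eqP eps /eqP er _].
    have [_ /and3P[rok wok shok]] := all_filter_cons e h4.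
    have {}auth : authentic_msig w ([:: Sv i], StCompletion B (root_of lvs) n).
      by move: auth; rewrite eps er /authentic /= andbT.
    rewrite er.
    split.
      by apply: (upd_sent_ok ok e) => //; rewrite /sent_ok /= rok wok auth shok.
    set shards := _ :: se_shards y; set cond := _ && _.
    set matching := map fst _.
    have mok : authentic_msig w (map Sv matching, StCompletion B (root_of lvs) n).
      rewrite authentic_aggregate all_map all_filter.
      have : all (fun z : server * (seq (leaf M) * nat) =>
          authentic_msig w ([:: Sv z.1], StCompletion B (root_of z.2.1) z.2.2)) shards.
        by rewrite /= auth shok.
      (* Every shard kept by the filter is for [(lvs, n)], so its token is on the very statement
         being aggregated. *)
      by apply: sub_all => -[j z'] /= h; apply/implyP => /eqP ez; rewrite ez in h.
    move: cond matching mok => [] // matching mok; rewrite /snd.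
    apply: effects_ok_unsigned.
      by elim: (zip _ _) => //= -[z [[[? ?] ?]|]] l.
    elim: (zip _ _) => //= -[z [[[? ?] ?]|]] l //= ->.
    by rewrite andbT /authentic /= andbT.
- case: x => //= [a m k sg E|ms] auth; split=> //; split=> //=.
  + move=> j; case: (learn _ _ _ _) => [c'|] //; case: ifP => // _.
    rewrite /upd; case: ifP => // _; rewrite all_rcons h1 andbT.
    case/andP: auth => /andP[sgok _] Eok; rewrite /submission_ok /= sgok /=.
    by case: ifP.
  + move=> j r; case e: (br_reducing s j) => [r'|] //= [<-].
    case: ifP => [/andP[/eqP ems _]|_]; last exact: h3 e.
    have /andP[subok sigok] := h3 _ _ e.
    rewrite /reducing_ok /= subok /= sigok andbT.
    by move: auth; rewrite ems /authentic /= andbT.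
Qed.

(** * Server handlers *)

Lemma sound_learn_all d assigns :
  sound_dir id_of d -> sound_dir id_of (learn_all id_of d assigns).
Proof.
rewrite /learn_all; elim: assigns d => //= -[j c] al IH d dok; apply: IH => i c'.
rewrite /learn /=; case: eqP => [<-|_]; last exact: dok.
by rewrite /upd; case: eqP => [-> [<-]|_ /dok].
Qed.

(** A straggler has signed its message directly. Any other correct client has multi-signed the
    reduction root after verifying a leaf with its own identifier, and distinctness of the
    identifiers forces that leaf to be the one of [e]. *)
Lemma signatures_ok_sent (w : world) d bt agg ssigs e c :
  inv w -> sound_dir id_of d -> uniq (b_ids bt) ->
  all (fun j => isSome (d j)) (b_ids bt) -> signatures_ok d bt agg ssigs ->
  all (authentic_sig w) (map snd ssigs) -> authentic_msig w agg ->
  e \in b_entries bt -> correct (Cl c) -> id_of c = e.1 -> sent c e.2.2.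
Proof.
move=> winv dok ubt known /and5P[_ _ sgok /eqP aggst /andP[others _]] sgauth aggauth.
move=> ebt corr idc; have eid : e.1 \in b_ids bt by apply: map_f.
(* The identifier is known, and a sound directory can map it to no other client since [id_of] is
   injective. *)
have dc : d e.1 = Some c.
  have := allP known _ eid; case dc': (d e.1) => [c'|] // _.
  by congr Some; apply: id_of_inj; rewrite idc; apply: dok.
have [strag|nostrag] := boolP (e.1 \in map fst (b_stragglers bt)).
  have := allP sgok _ strag; rewrite (lookup_uniq ubt ebt) dc.
  case: e.2 => k m; case: (lookup (b_stragglers bt) _) => // q.
  case sge: (lookup ssigs e.1) => [sg|] // /eqP esg.
  have := allP sgauth sg (map_f snd (lookup_mem sge)).
  rewrite /authentic_sig esg /= (negPf corr) /=.
  exact: (inv_signed winv).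
have : Cl c \in agg.1.
  apply: (allP others); apply: map_f; rewrite mem_pmap -dc; apply: map_f.
  by rewrite mem_filter nostrag.
move/(allP aggauth); rewrite (negPf corr) /= => /(inv_multisigned winv).
rewrite aggst => -[m [k [pf [/verify_in vf cm]]]].
case/mapP: vf => e' e'bt [idc' _ em]; suff -> : e.2.2 = m by [].
(* Looking up the common identifier of [e] and [e'] yields both payloads, which therefore agree. *)
have := lookup_uniq ubt e'bt; rewrite -idc' idc (lookup_uniq ubt ebt).
by case=> ->.
Qed.

(** Among [f + 1] signing servers at least one is correct, and a correct server multi-signs a
    witness only for a good root. *)
Lemma certified_good_root (w : world) k W :
  inv w -> authentic_msig w W -> certified (StWitness k) W -> good_root k.1.1.
Proof.
move=> winv auth /andP[/eqP est big].
have [i iW icorr] : exists2 i : server, Sv i \in W.1 & correct (Sv i).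
  case: (pickP [pred i : server | (Sv i \in W.1) && correct (Sv i)]) => [i /andP[]|no].
    by exists i.
  suff : #|[set i : server | Sv i \in W.1]| <= f by rewrite leqNgt -addn1 big.
  apply: leq_trans byz_servers; apply: subset_leq_card; apply/subsetP => i.
  by rewrite !inE => iW; have := no i; rewrite /= iW => /negbFE.
have := allP auth _ iW; rewrite (negPf icorr) est /=.
exact: (inv_multisigned winv).
Qed.

Lemma collect_ok k (s : sstate) : server_ok s -> server_ok (collect k s).
Proof.
case=> h1 h2 h3 h4; rewrite /collect; case: ifP => // _.
split=> //= k' bt; rewrite /upd; case: ifP => // _; [exact: h2|exact: h3].
Qed.

Lemma set_dir_ok assigns (s : sstate) :
  server_ok s -> server_ok (set_dir (learn_all id_of (s_dir s) assigns) s).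
Proof. by case=> h1 h2 h3 h4; split=> //; apply: sound_learn_all. Qed.

Lemma uniq_sort_batch ids (payloads : seq (nat * M)) stragglers :
  uniq ids -> size ids = size payloads ->
  uniq (b_ids (sort_batch (MkBatch (zip ids payloads) stragglers))).
Proof.
move=> uids sz; rewrite /b_ids /=.
rewrite (perm_uniq (perm_map fst (permEl (perm_sort _ _)))).
by rewrite -/(unzip1 _) unzip1_zip ?sz.
Qed.

Lemma server_recv_ok (w : world) i src x (s : sstate) :
  inv w -> server_ok s -> authentic w x ->
  server_ok (server_recv id_of i src x s).1 /\
  effects_ok (Sv i) w (server_recv id_of i src x s).2.
Proof.
move=> winv ok; have [h1 h2 h3 h4] := ok; have fx0 := effects_ok0 (Sv i) w.
case: src => [c|b|j] //.
- case: x => [||||num ids payloads stragglers||r num assigns agg ssigs||r num W|||||] auth //;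
    rewrite /server_recv; cbv zeta.
  + set bt := sort_batch _.
    case: ifP => // /and5P[_ /eqP enum _ uids /eqP sz].
    split; last exact: effects_ok_unsigned.
    split=> //= k bt'; rewrite /upd; case: ifP => [/eqP -> [<-] //|_].
    * exact: h2.
    * by move=> _; apply: uniq_sort_batch.
    * exact: h3.
  + split; first exact: set_dir_ok.
    rewrite /snd; case ebt: (s_batches s _) => [bt|] //.
    case: ifP => // /and4P[_ /eqP enum known sigsok].
    move: auth; rewrite /authentic /= andbT => /andP[sgauth aggauth].
    split=> //=; last first.
      move=> st; rewrite inE => /eqP -> /= ls id q m c /=.
      (* Collision-freeness identifies an arbitrary list [ls] under this root with the leaves of the
         stored batch. *)
      have /= -> := h2 _ _ ebt; move=> /root_of_inj <- /mapP[e ee [-> _ ->]] corr idc.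
      apply: (signatures_ok_sent winv _ _ known sigsok) => //.
        exact: sound_learn_all.
      (* The batch carries the expected number, so it is not ordered yet and its identifiers are
         still known to be distinct. *)
      by apply: (h3 _ _ ebt) => /=; rewrite enum.
    by rewrite andbT /authentic /= /authentic_msig /= mem_cat inE eqxx !orbT.
  + rewrite /snd; case: ifP => // _; by split=> //; apply: effects_ok_unsigned.
- case: x => [||||||||||k|k bt assigns|k|k] auth //;
    rewrite /server_recv; cbv zeta.
  + by rewrite /snd; case: (s_batches s k).
  + case: ifP => // /andP[kpool _]; case: ifP => [/andP[_ /eqP er]|_]; last first.
      by split=> //; apply: set_dir_ok.
    split=> //; split=> /=; first exact: sound_learn_all.
    * by move=> k' bt'; rewrite /upd; case: ifP => [/eqP -> [<-]|_ /h2].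
    * move=> k' bt'; rewrite /upd; case: ifP => [/eqP -> _|_]; last exact: h3.
      (* A batch is fetched only for a key in the pool, whose number is below the expected one; the
         distinctness clause is then vacuous. *)
      by rewrite leqNgt (h4 _ kpool).1.
    * exact: h4.
  + by rewrite /snd; case: ifP => // _; split=> //; apply: effects_ok_unsigned.
  + by split=> //; apply: collect_ok.
Qed.

Lemma server_stob_ok (w : world) i b r W (s : sstate) :
  inv w -> server_ok s -> authentic_msig w W ->
  server_ok (server_stob (b, r, W) s).1 /\
  effects_ok (Sv i) w (server_stob (b, r, W) s).2.
Proof.
move=> winv ok auth; have [h1 h2 h3 h4] := ok; rewrite /server_stob.
case: ifP => [cert|_]; last by split=> //; apply: effects_ok0.
split; last first.
  rewrite /snd; case: ifP => _; first exact: effects_ok0.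
  by apply: effects_ok_unsigned;
    rewrite ?send_servers_unsigned ?send_servers_ok.
(* Expected numbers only grow, which weakens the distinctness clause and preserves the bound on the
   keys in the pool. *)
have num_le b' : s_num s b' <= upd (s_num s) b (s_num s b).+1 b'.
  by rewrite /upd; case: eqP => // ->.
split=> //= [k bt ek le|k].
  by apply: (h3 _ _ ek); apply: leq_trans le.
rewrite mem_rcons inE => /predU1P[->|/h4[lt good]]; last first.
  by split=> //; apply: leq_trans (num_le _).
split=> /=; first by rewrite /upd eqxx.
exact: (certified_good_root winv auth cert).
Qed.

Lemma server_complete_ok (w : world) i (s : sstate) :
  server_ok s ->
  server_ok (server_complete i s).1 /\
  effects_ok (Sv i) w (server_complete i s).2.
Proof.
move=> ok; have [h1 h2 h3 h4] := ok; have fx0 := effects_ok0 (Sv i) w.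
rewrite /server_complete; case epool: (s_pool s) => [|k pool] //.
case: (s_batches s k) => [bt|] //; cbv zeta.
case: (complete_entries _ _ _ _) => [[last ls] ds]; split.
  apply: collect_ok; split=> //= k' k'pool.
  by apply: h4; rewrite epool inE k'pool orbT.
rewrite /snd; set st := StCompletion _ _ _; set diff := map _ _.
split.
- rewrite !all_cat all_map /= send_servers_ok /= andbT.
  apply/andP; split; first by rewrite (eq_all (a2 := predT)) ?all_predT.
  rewrite /authentic /= andbT /authentic_msig /= mem_cat.
  by rewrite /multisigns !pmap_cat map_cat mem_cat /= inE eqxx !orbT.
- by [].
- move=> s'; rewrite /multisigns !pmap_cat /= -!/(multisigns _) !multisigns_unsigned.
  + by rewrite inE => /eqP ->.
  + exact: send_servers_unsigned.
  + by rewrite all_map (eq_all (a2 := predT)) ?all_predT.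
Qed.

(** * Preservation of the invariant by every action *)

Lemma inv_act_client (w : world) c g :
  inv w ->
  client_ok w c (g (w_clients w c)).1 /\
    effects_ok (Cl c) w (g (w_clients w c)).2 ->
  inv (act_client c g w).
Proof.
rewrite /act_client => winv; case: (g _) => s fx /= [sok fxok].
have [h1 h2 h3 _ _ _ _] := winv.
by apply: (inv_emit winv fxok) => //= c'; rewrite /upd; case: eqP => // ->.
Qed.

Lemma inv_act_broker (w : world) b g :
  inv w ->
  broker_ok w b (g (w_brokers w b)).1 /\
    effects_ok (Br b) w (g (w_brokers w b)).2 ->
  inv (act_broker b g w).
Proof.
rewrite /act_broker => winv; case: (g _) => s fx /= [sok fxok].
have [h1 h2 h3 _ _ _ _] := winv.
by apply: (inv_emit winv fxok) => //= b'; rewrite /upd; case: eqP => // ->.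
Qed.

Lemma inv_act_server (w : world) i g :
  inv w ->
  server_ok (g (w_servers w i)).1 /\
    effects_ok (Sv i) w (g (w_servers w i)).2 ->
  inv (act_server i g w).
Proof.
rewrite /act_server => winv; case: (g _) => s fx /= [sok fxok].
have [h1 h2 h3 _ _ _ _] := winv.
by apply: (inv_emit winv fxok) => //= i'; rewrite /upd; case: eqP => // ->.
Qed.

Lemma all_onth (T : Type) (a : pred T) l j x :
  all a l -> onth l j = Some x -> a x.
Proof.
by elim: l j => [|y l IH] [|j] //= /andP[ay al]; [case=> <-|apply: IH].
Qed.

Lemma inv_set_received js (w : world) : inv w -> inv (set_received js w).
Proof.
case=> h1 h2 h3 h4 h5 h6 h7; split=> // b.
by apply: broker_ok_mono (h2 b); split=> ?.
Qed.

Lemma inv_set_log l (w : world) : inv w -> inv (set_log l w).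
Proof.
case=> h1 h2 h3 h4 h5 h6 h7; split=> // b.
by apply: broker_ok_mono (h2 b); split=> ?.
Qed.

(** The predicate [sent] stays fixed during the step, so it must already include a message being
    broadcast. A STOB delivery must have been broadcast earlier, for then its certificate is known
    to be authentic. *)
Lemma inv_run (w : world) a :
  inv w -> enabled byz w a ->
  (forall c m b, a = ClBroadcast f H c m b -> sent c m) ->
  (forall i x, a = StobDeliver i x -> exists p, (p, x) \in w_stob w) ->
  inv (run id_of a w).
Proof.
move=> winv; have [h1 h2 h3 hnet hstob _ _] := winv.
case: a => [|p q x|i x|j|c m b|c m ob|b i|b|b j|i x|i] /=.
- by [].
- case=> _ auth _ _; apply: (inv_emit winv) => //.
  by apply: effects_ok_unsigned => //=; rewrite auth.
- case=> _ auth _ _; apply: (inv_emit winv) => //.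
  by apply: effects_ok_unsigned => //=; rewrite auth.
- case=> _ [pk epk _] _ _; rewrite epk; have := all_onth hnet epk.
  have winv' := inv_set_received (j :: w_received w) winv.
  case: pk {epk} => src [c|b|i] x /= auth.
  + by apply: inv_act_client => //; apply: client_recv_ok => //;
      apply: (inv_clients winv').
  + by apply: inv_act_broker => //; apply: broker_recv_ok => //;
      apply: (inv_brokers winv').
  + by apply: inv_act_server => //; apply: server_recv_ok => //;
      apply: (inv_servers winv').
- move=> _ bc _; apply: inv_act_client => //; apply: client_submit_ok;
    last exact: bc.
  have [pend ev] := h1 c; split=> // m' /=; rewrite inE => /predU1P[->|/pend //].
  exact: bc.
- case=> _ _ mob _ _; apply: inv_act_client => //; rewrite /client_timer.
  (* A message is submitted again only while it is pending, and pending messages have been sent. *)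
  case: ob mob => [b /andP[mp _]|_].
    by apply: client_submit_ok; [apply: h1|apply: (h1 c).1].
  by split; [apply: h1|apply: effects_ok0].
- move=> _ _ _; have [_ _ _ _ _ sg msg] := winv; split=> //= b'.
  apply: (@broker_ok_mono w); first by split=> ?.
  by rewrite /upd; case: eqP => // ->; apply: broker_pool_ok.
- by move=> _ _ _; apply: inv_act_broker => //; apply: broker_flush_ok.
- by move=> _ _ _; apply: inv_act_broker => //; apply: broker_send_ok.
- move=> _ _ hx.
  have winv' := inv_set_log (upd (w_log w) i (rcons (w_log w i) x)) winv.
  apply: inv_act_server => //; case: x hx {winv'} (winv') => [[b r] W] hx winv'.
  have [p hp] := hx _ _ erefl.
  apply: server_stob_ok => //; last exact: (hstob _ _ hp).
  exact: (inv_servers winv').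
- by move=> _ _ _; apply: inv_act_server => //; apply: server_complete_ok.
Qed.

(** * From deliveries back to broadcasts *)

Lemma complete_entries_deliveries d (bt : batch M) last es oc m :
  (oc, m) \in (complete_entries d bt last es).2 ->
  exists2 e, e \in es & (oc : option C) = d e.1 /\ m = e.2.2.
Proof.
elim: es last => //= e es IH last.
have IH' last' : (oc, m) \in (complete_entries d bt last' es).2 ->
    exists2 e', e' \in e :: es & oc = d e'.1 /\ m = e'.2.2.
  by move=> /IH[e' e'es h]; exists e' => //; rewrite inE e'es orbT.
have skip l : (oc, m) \in (let: (last', ls, ds) := complete_entries d bt last es in
    (last', l :: ls, ds)).2 -> exists2 e', e' \in e :: es & oc = d e'.1 /\ m = e'.2.2.
  by have := IH' last; case: (complete_entries _ _ _ _) => [[? ?] ?].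
have deliver q : (oc, m) \in (let: (last', ls, ds) :=
      complete_entries d bt (upd last e.1 (Some (q, e.2.2))) es in
      (last', Some (e.1, q, e.2.2) :: ls, (d e.1, e.2.2) :: ds)).2 ->
    exists2 e', e' \in e :: es & oc = d e'.1 /\ m = e'.2.2.
  have := IH' (upd last e.1 (Some (q, e.2.2))).
  case: (complete_entries _ _ _ _) => [[? ?] ?] /= h.
  rewrite inE => /predU1P[[-> ->]|/h //].
  by exists e; rewrite ?mem_head.
case: (last e.1) => [[q' m']|]; last exact: deliver.
case: ifP => _; first exact: skip.
case: ifP => _; first exact: skip.
by case: ifP => _; [apply: deliver|apply: skip].
Qed.

(** The head of the pool has a good root, the stored batch has that root, and soundness of the local
    directory gives [c] the identifier of the delivered entry. *)
Lemma complete_sent (i : server) (s : sstate) c m :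
  server_ok s -> correct (Cl c) ->
  (Some c, m) \in deliveries (server_complete i s).2 -> sent c m.
Proof.
case=> h1 h2 _ h4 corr; rewrite /server_complete.
case epool: (s_pool s) => [|k pool] //; case ebt: (s_batches s k) => [bt|] //.
have := @complete_entries_deliveries (s_dir s) bt (s_last s) (b_entries bt) (Some c) m.
cbv zeta; case: (complete_entries _ _ _ _) => [[last ls] ds] mem_ds.
rewrite /snd; set diff := map _ (filter _ _).
have -> : deliveries ([seq Deliver B f H x.1 x.2 | x <- ds] ++
    [:: MultiSign C f (StCompletion B (root_of ls) (s_count s));
        Send (Br k.1.2) (CompletionShard k ([:: Sv i],
          StCompletion B (root_of ls) (s_count s)) diff)] ++
    send_servers (Collection C f k)) = ds.
  rewrite /deliveries !pmap_cat /=.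
  have -> : pmap (fun e => if e is Deliver c m then Some (c, m) else None)
      (send_servers (Collection C f k)) = [::].
    by rewrite /send_servers; elim: (servers f).
  rewrite cats0. elim: {mem_ds diff} ds => //= -[? ?] ? IH. by rewrite IH.
case/mem_ds=> e ebte [dc ->].
have [|_ good] := h4 k; first by rewrite epool mem_head.
apply: (good _ _ (b_seqno bt e) _ _ (h2 _ _ ebt) _ corr (h1 _ _ (esym dc))).
by apply/mapP; exists e.
Qed.

End Invariant.

(** The predicate of sent messages occurs only positively in the invariant, so it may grow with
    time. *)
Lemma inv_mono (M C B : eqType) (f : nat) (id_of : C -> nat)
    (H : merkle (leaf M)) (byz : pred (proc C B f)) (P Q : C -> M -> Prop) w :
  (forall c m, P c m -> Q c m) ->
  inv id_of (H := H) byz P w -> inv id_of byz Q w.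
Proof.
move=> PQ; have good r : good_root id_of byz P r -> good_root id_of (H := H) byz Q r.
  by move=> h ls id q m c er mem_ls corr idc; apply: PQ; apply: (h ls id q).
case=> h1 h2 h3 h4 h5 h6 h7; split=> //.
- by move=> c; have [pend ev] := h1 c; split=> // m /pend /PQ.
- move=> i; have [g1 g2 g3 g4] := h3 i; split=> // k /g4[lt gk].
  by split=> //; apply: good.
- by move=> [c|b|i] [m n|r|k|r n] /h6 //= /PQ.
- move=> [c|b|i] [m n|r|k|r n] /h7 //=; last exact: good.
  by case=> m [k [pf [vf /PQ]]]; exists m, k, pf.
Qed.

Theorem theorem2 (M C B : eqType) (f : nat) (id_of : C -> nat)
    (H : merkle (leaf M)) (byz : pred (proc C B f))
    (tr : nat -> world C B f H) (act : nat -> action C B f H)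
    (id_of_inj : injective id_of)
    (byz_servers : #|[set i : server f | byz (Sv i)]| <= f)
    (correct_broker : exists b : B, correct byz (Br b))
    (exec : execution id_of byz tr act) :
  forall (t : nat) (i : server f) (chi : C) (m : M),
    correct byz (Sv i) -> correct byz (Cl chi) ->
    delivers tr act t i chi m ->
    exists2 t', t' < t & broadcasts act t' chi m.
Proof.
move=> t i chi m icorr chicorr [_ mem_del].
have [init en step stob _] := exec.
(* The bound is strict: a delivery at time [t] is computed from [tr t], and a broadcast at time [t]
   becomes part of the past at [t.+1]. *)
pose past t (c : C) (m : M) := exists2 t', t' < t & broadcasts act t' c m.
suff /inv_servers/(_ i) sok : inv id_of byz (past t) (tr t).
  exact: complete_sent sok chicorr mem_del.
elim: t {mem_del} => [|t IH].
  have [bd [sd [_ sdok ->]]] := init.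
  by split=> //= *; split=> //=.
rewrite step; apply: inv_run => //.
- apply: inv_mono IH => c m' [t' lt bc]; exists t' => //.
  exact: ltnW.
- by move=> c m' b et; exists t => //; exists b.
- move=> j x et.
  have jcorr : correct byz (Sv j) by have := en t; rewrite et.
  (* The delivery enters the log at [t.+1], so STOB integrity yields a broadcast recorded by then.
     Handling a delivery broadcasts nothing, so the record already existed at [t]. *)
  have : x \in w_log (tr t.+1) j.
    rewrite step et /= /act_server; case: (server_stob _ _) => s fx /=.
    by rewrite /upd eqxx mem_rcons mem_head.
  case/(stob_integrity stob jcorr) => j' xj'; exists (Sv j').
  move: xj'; rewrite step et /= /act_server.
  case: x {et} => [[b r] W]; rewrite /server_stob.
  case: ifP => _ /=; last by rewrite cats0.
  case: ifP => _ /=; first by rewrite cats0.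
  have -> : stob_broadcasts
      (send_servers
        (RequestBatch C f (r, b, s_num (w_servers (tr t) j) b))) = [::].
    by rewrite /send_servers; elim: (servers f).
  by rewrite cats0.
Qed.
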